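(* Let $I=\langle g_1,\dots,g_l\rangle\subseteq\mathcal{O}_{X(S)}$ be the ideal generated by the set $\{g_1,\dots,g_l\}\subset\mathcal{O}_{X(S)}$. Then $C(\overline{I})\subseteq\Gamma_+(I)$.
   Context: $S\subset\mathbb{Z}^n_+$ is a semigroup generated by a finite set $\{b_1,\dots,b_r\}\subset\mathbb{Z}^n_+$ with $\mathbb{Z}b_1+\cdots+\mathbb{Z}b_r=\mathbb{Z}^n$. The affine toric variety is $X(S)=V(I_S)\subset\mathbb{C}^r$, where $I_S=\langle x^{\alpha_+}-x^{\alpha_-}:\alpha\in\mathbb{Z}^r,\ \sum_i\alpha_ib_i=0\rangle\subset\mathbb{C}[x_1,\dots,x_r]$, $\alpha_+=\sum_{\alpha_i>0}\alpha_ie_i$, $\alpha_-=-\sum_{\alpha_i<0}\alpha_ie_i$ (not necessarily normal). $\mathcal{O}_{X(S)}$ is the ring of germs at $0$ of analytic functions on $X(S)$: each $g\in\mathcal{O}_{X(S)}$ is $g=f|_{X(S)}$ with $f:\mathbb{C}^r\to\mathbb{C}$ analytic, with Taylor expansion $f=\sum_ka_kx^k$, where $x^k=x_1^{k_1}\cdots x_r^{k_r}$. $cone(S)=\{\sum_i\lambda_ib_i:\lambda_i\in\mathbb{R},\ \lambda_i\ge0\}\subset\mathbb{R}^n$ is assumed of dimension $n$ and strongly convex ($cone(S)\cap(-cone(S))=\{0\}$). For $A\subset S$, $\Gamma_+(A)$ is the convex hull of $\{k+v:k\in A,\ v\in cone(S)\}$. For $g=f|_{X(S)}$ with $f=\sum_ka_kx^k$,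 $supp(g)=\{k_1b_1+\cdots+k_rb_r\in S: a_k\ne0,\ k=(k_1,\dots,k_r)\}$. For $G\subseteq\mathcal{O}_{X(S)}$, $supp(G)$ is the union of the supports of the elements of $G$ and $\Gamma_+(G)=\Gamma_+(supp(G))$; if $I$ is the ideal generated by $G$, $\Gamma_+(I)=\Gamma_+(G)$. $\overline{I}$ is the integral closure of $I$: the ideal of all $h\in\mathcal{O}_{X(S)}$ satisfying a relation $h^m+a_1h^{m-1}+\cdots+a_m=0$ with $a_i\in I^i$. $C(\overline{I})$ is the convex hull in $cone(S)$ of the set $\{\lambda_1b_1+\cdots+\lambda_rb_r: x^\lambda\in\overline{I}\}$, $\lambda=(\lambda_1,\dots,\lambda_r)$. *)

(* Defs.v *)
From HB Require Import structures.
From mathcomp Require Import all_boot all_order all_algebra.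
From mathcomp Require Import all_classical all_reals all_analysis.
From mathcomp Require Import complex.
(* The notations of mpoly clash with those of mathcomp-analysis. *)
From mathcomp Require Import -(notations) mpoly.

Set Implicit Arguments.
Unset Strict Implicit.
Unset Printing Implicit Defensive.

Import Order.TTheory GRing.Theory Num.Theory numFieldNormedType.Exports.
Local Open Scope classical_set_scope.
Local Open Scope ring_scope.
Local Open Scope quotient_scope.

Section ideals.
Variable A : comPzRingType.

Definition is_ideal (I : set A) : Prop :=
  [/\ I 0, forall x y, I x -> I y -> I (x + y)
    & forall a x, I x -> I (a * x)].

Definition ideal_gen (G : set A) : set A := smallest is_ideal G.

Definition ideal_pow (I : set A) (k : nat) : set A :=
  ideal_gen [set x | exists2 u : 'I_k -> A,
                       forall j, I (u j) & x = \prod_(j < k) u j].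

Definition integral_closure (I : set A) : set A :=
  [set h | exists m : nat, exists a : nat -> A,
     [/\ (0 < m)%N,
         forall i, (1 <= i <= m)%N -> ideal_pow I i (a i)
       & h ^+ m + \sum_(1 <= i < m.+1) a i * h ^+ (m - i) = 0]].

End ideals.

(* R[i], as a numFieldType so that it carries its norm topology. *)
Definition Cplx (R : realType) : numFieldType := R[i].

(* Sums of families indexed by the multi-indices k in N^r: the sum is the
   limit of the partial sums over |k| < N, and absolute convergence is
   required, so that the order of summation is irrelevant. *)
Section multi_sums.
Variables (K : numFieldType) (r : nat).
Implicit Types u v : multinom r -> K.

Definition psum u (N : nat) : K := \sum_(k : bmultinom r N) u k.

Definition has_sum u (s : K) : Prop :=
  (exists M : K, forall N, psum (fun k => `|u k|) N <= M) /\
  psum u @ \oo --> s.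

Definition cprod u v (k : multinom r) : K :=
  \sum_(k1 : bmultinom r (mdeg k).+1)
   \sum_(k2 : bmultinom r (mdeg k).+1 | k == mnm_add k1 k2) u k1 * v k2.

Lemma psum_widen u D N : (D <= N)%N ->
  \sum_(k : bmultinom r D) u k = \sum_(k : bmultinom r N | (mdeg k < D)%N) u k.
Proof.
move=> DN.
pose h (k : bmultinom r D) : bmultinom r N :=
  BMultinom (leq_trans (bmdeg k) DN).
have hinj : injective h by move=> k l /(congr1 (@bmnm _ _)) /= /val_inj.
rewrite -[LHS](big_map h xpredT (fun k : bmultinom r N => u k)).
rewrite -[RHS]big_filter; apply: perm_big; apply: uniq_perm.
- by rewrite map_inj_uniq // index_enum_uniq.
- by rewrite filter_uniq // index_enum_uniq.
move=> k; rewrite mem_filter mem_index_enum andbT.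
apply/mapP/idP => [[l _ ->]|kD]; first exact: (bmdeg l).
exists (BMultinom kD); first exact: mem_index_enum.
exact: val_inj.
Qed.

Lemma cprod_widen u v (k : multinom r) N : (mdeg k < N)%N ->
  cprod u v k = \sum_(k1 : bmultinom r N)
    \sum_(k2 : bmultinom r N | k == mnm_add k1 k2) u k1 * v k2.
Proof.
move=> kN; rewrite /cprod.
pose F k1 D := \sum_(k2 : bmultinom r D | k == mnm_add k1 k2) u k1 * v k2.
have FE (k1 : multinom r) : F k1 (mdeg k).+1 = F k1 N.
  rewrite /F big_mkcond/=.
  rewrite (psum_widen (fun k2 => if k == mnm_add k1 k2 then u k1 * v k2 else 0) kN).
  rewrite -big_mkcondr; apply: eq_bigl => k2.
  case: (altP (k =P _)) => [kE|]; last by rewrite andbF.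
  by rewrite andbT ltnS kE mdegD leq_addl.
transitivity (\sum_(k1 : bmultinom r (mdeg k).+1) F k1 N).
  by apply: eq_bigr => k1 _; exact: FE.
rewrite (psum_widen (fun k1 => F k1 N) kN) [RHS](bigID (fun k1 : bmultinom r N => mdeg k1 < (mdeg k).+1)%N) /=.
rewrite [X in _ + X]big1 ?addr0// => k1 k1k.
rewrite big1// => k2 /eqP kE; move: k1k.
by rewrite kE mdegD ltnS leq_addr.
Qed.

Lemma psum_cprod u v N : psum (cprod u v) N =
  \sum_(k1 : bmultinom r N)
    \sum_(k2 : bmultinom r N | (mdeg (mnm_add k1 k2) < N)%N) u k1 * v k2.
Proof.
rewrite /psum (eq_bigr _ (fun k _ => cprod_widen u v (bmdeg k))).
rewrite exchange_big/=; apply: eq_bigr => k1 _.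
rewrite [LHS](exchange_big_dep xpredT)//= [RHS]big_mkcond/=.
apply: eq_bigr => k2 _; case: ifP => [kN|/negP kN].
  by rewrite (big_pred1 (BMultinom kN)).
by rewrite big_pred0// => k; apply/negP => /eqP kE; apply: kN; rewrite -kE bmdeg.
Qed.

Lemma psum_mul u v N : psum u N * psum v N =
  \sum_(k1 : bmultinom r N) \sum_(k2 : bmultinom r N) u k1 * v k2.
Proof.
by rewrite /psum mulr_suml; apply: eq_bigr => k1 _; rewrite mulr_sumr.
Qed.

Lemma psum_nd u : (forall k, 0 <= u k) ->
  {homo psum u : n m / (n <= m)%N >-> n <= m}.
Proof.
move=> u0 n m nm; rewrite /psum (psum_widen u nm) [leRHS](bigID (fun k : bmultinom r m => mdeg k < n)%N) /=.
by rewrite lerDl sumr_ge0.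
Qed.

Lemma psum_ge0 u N : (forall k, 0 <= u k) -> 0 <= psum u N.
Proof. by move=> u0; apply: sumr_ge0. Qed.

End multi_sums.

Section has_sum_theory.
Variables (K : numFieldType) (r : nat).
Implicit Types u v : multinom r -> K.

Lemma has_sumB u v s t :
  has_sum u s -> has_sum v t -> has_sum (fun k => u k - v k) (s - t).
Proof.
move=> [[M uM] us] [[M' vM] vt]; split.
  exists (M + M') => N; apply: le_trans (lerD (uM N) (vM N)).
  by rewrite /psum -big_split/=; apply: ler_sum => k _; exact: ler_normB.
have -> : psum (fun k => u k - v k) = (fun N => psum u N - psum v N).
  by apply/funext => N; rewrite /psum big_split/= sumrN.
exact: (@cvgB K K _ _ _ (psum u) (psum v) s t us vt).
Qed.

Lemma has_sumM_cvg u v s t :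
  cvgn (psum (fun k => `|u k|)) -> cvgn (psum (fun k => `|v k|)) ->
  has_sum u s -> has_sum v t -> has_sum (cprod u v) (s * t).
Proof.
move=> cu cv us vt.
set A := psum (fun k => `|u k|) in cu; set B := psum (fun k => `|v k|) in cv.
have A0 N : 0 <= A N by exact: psum_ge0.
have B0 N : 0 <= B N by exact: psum_ge0.
move: us vt => [[M uM] us] [[M' vM] vt].
have low N : psum (cprod (fun k => `|u k|) (fun k => `|v k|)) N <= A N * B N.
  rewrite psum_cprod psum_mul; apply: ler_sum => k1 _.
  rewrite [leRHS](bigID (fun k2 : bmultinom r N => mdeg (mnm_add k1 k2) < N)%N) /=.
  by rewrite lerDl; apply: sumr_ge0 => k2 _; exact: mulr_ge0.
split.
  exists (M * M') => N; apply: (@le_trans _ _ (A N * B N)); last first.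
    exact: ler_pM (A0 N) (B0 N) (uM N) (vM N).
  apply: le_trans (low N); apply: ler_sum => k _.
  rewrite /cprod; apply: le_trans (ler_norm_sum _ _ _) _.
  apply: ler_sum => k1 _; apply: le_trans (ler_norm_sum _ _ _) _.
  by apply: ler_sum => k2 _; rewrite normrM.
have half_cvg : (fun N : nat => N./2) @ \oo --> \oo.
  apply/cvgnyPge => m; exists m.*2 => // n /= mn.
  by rewrite -(doubleK m) half_leq.
pose D N := A N * B N - A N./2 * B N./2.
have D0 : D @ \oo --> (0 : K).
  rewrite -(subrr (limn A * limn B)); apply: cvgB; first exact: cvgM.
  by apply: cvgM; [apply: (cvg_comp _ A half_cvg)|apply: (cvg_comp _ B half_cvg)].
have dist N : `|psum u N * psum v N - psum (cprod u v) N| <= D N.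
  rewrite psum_mul psum_cprod -sumrB.
  have -> : \sum_(k1 : bmultinom r N)
      (\sum_(k2 : bmultinom r N) u k1 * v k2 -
       \sum_(k2 : bmultinom r N | (mdeg (mnm_add k1 k2) < N)%N) u k1 * v k2) =
      \sum_(k1 : bmultinom r N)
       \sum_(k2 : bmultinom r N | ~~ (mdeg (mnm_add k1 k2) < N)%N) u k1 * v k2.
    apply: eq_bigr => k1 _.
    rewrite (bigID (fun k2 : bmultinom r N => mdeg (mnm_add k1 k2) < N)%N) /=.
    by rewrite addrAC subrr add0r.
  apply: (@le_trans _ _ (\sum_(k1 : bmultinom r N)
      \sum_(k2 : bmultinom r N | ~~ (mdeg (mnm_add k1 k2) < N)%N) `|u k1| * `|v k2|)).
    apply: le_trans (ler_norm_sum _ _ _) _; apply: ler_sum => k1 _.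
    apply: le_trans (ler_norm_sum _ _ _) _; apply: ler_sum => k2 _.
    by rewrite normrM.
  rewrite /D lerBrDr /A /B.
  apply: (@le_trans _ _ (\sum_(k1 : bmultinom r N)
      \sum_(k2 : bmultinom r N | ~~ (mdeg (mnm_add k1 k2) < N)%N) `|u k1| * `|v k2| +
    psum (cprod (fun k => `|u k|) (fun k => `|v k|)) N)).
    rewrite lerD2l psum_cprod psum_mul.
    have hN : (N./2 <= N)%N by rewrite -divn2 leq_div.
    rewrite (psum_widen (fun k1 => \sum_(k2 : bmultinom r N./2) `|u k1| * `|v k2|) hN).
    rewrite big_mkcond/=; apply: ler_sum => k1 _; case: ifP => [k1h|_]; last first.
      by apply: sumr_ge0 => k2 _; exact: mulr_ge0.
    rewrite (psum_widen (fun k2 => `|u k1| * `|v k2|) hN).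
    rewrite [leLHS]big_mkcond [leRHS]big_mkcond/=; apply: ler_sum => k2 _.
    case: ifP => [k2h|_].
      rewrite ifT// mdegD -[ltnRHS]odd_double_half -addnn.
      by rewrite (leq_trans _ (leq_addl _ _))// -addSn leq_add// ltnW.
    by case: ifP => // _; exact: mulr_ge0.
  rewrite psum_cprod psum_mul -big_split/=; apply: ler_sum => k1 _.
  rewrite [leRHS](bigID (fun k2 : bmultinom r N => mdeg (mnm_add k1 k2) < N)%N) /=.
  by rewrite addrC.
have E0 : (fun N => psum u N * psum v N - psum (cprod u v) N) @ \oo --> (0 : K).
  apply/cvgrPdist_lt => e e0.
  move/cvgrPdist_lt : D0 => /(_ e e0); apply: filterS => N.
  rewrite !sub0r !normrN; apply: le_lt_trans; apply: le_trans (dist N) _.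
  by rewrite ger0_norm// (le_trans _ (dist N)).
have -> : psum (cprod u v) = (fun N => psum u N * psum v N -
   (psum u N * psum v N - psum (cprod u v) N)).
  by apply/funext => N; rewrite opprB addrC subrK.
by rewrite -[s * t]subr0; apply: cvgB => //; exact: cvgM.
Qed.

Lemma has_sum1 (m : multinom r) (c : K) :
  has_sum (fun k => if k == m then c else 0) c.
Proof.
have E (c' : K) N : psum (fun k : multinom r => if k == m then c' else 0) N =
    if (mdeg m < N)%N then c' else 0.
  rewrite /psum -big_mkcond/=; case: ifP => [mN|/negP mN].
    by rewrite (big_pred1 (BMultinom mN)).
  rewrite big_pred0// => k; apply/negP => /eqP kE; apply: mN.
  by rewrite -kE bmdeg.
split.
  exists `|c| => N.
  have -> : (fun k : multinom r => `|if k == m then c else 0|) =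
            (fun k => if k == m then `|c| else 0).
    by apply/funext => k; case: ifP => // _; rewrite normr0.
  by rewrite E; case: ifP.
apply: cvg_near_cst; exists (mdeg m).+1 => // N /= mN.
by rewrite E mN.
Qed.

End has_sum_theory.

Section complex_has_sum.
Variables (R : realType) (r : nat).
Local Notation C := (Cplx R).
Implicit Types u v : multinom r -> C.

Lemma nondecreasing_bounded_cvgn (s : nat -> C) (M : C) :
  (forall n, 0 <= s n) -> {homo s : n m / (n <= m)%N >-> n <= m} ->
  (forall n, s n <= M) -> cvgn s.
Proof.
move=> s0 snd sM.
have sE n : s n = ((complex.Re (s n))%:C)%C.
  by rewrite RRe_real //; apply: ger0_real; exact: s0.
have ndR : nondecreasing_seq (fun n => complex.Re (s n)).
  by move=> n m /snd; rewrite [_ <= _]lecE => /andP[].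
have /cvg_ex[l sl] : cvgn (fun n => complex.Re (s n)).
  apply: nondecreasing_is_cvgn => //; exists (complex.Re M) => _ [n _ <-].
  by have := sM n; rewrite [_ <= _]lecE => /andP[].
apply/cvg_ex; exists (l%:C)%C.
apply/cvgrPdist_lt => e e0.
have nE (x : R) : `|((x%:C)%C : C)| = ((`|x|)%:C)%C.
  rewrite -[LHS]/(Num.Def.normr ((x%:C)%C : R[i])) normc_def /=.
  by rewrite expr0n/= addr0 sqrtr_sqr.
have eE : e = ((complex.Re e)%:C)%C.
  by rewrite RRe_real //; apply: ger0_real; exact: ltW.
have Re0 : 0 < complex.Re e by move: e0; rewrite [_ < _]ltcE => /andP[].
move/cvgrPdist_lt : sl => /(_ _ Re0); apply: filterS => n.
rewrite [in X in _ -> X]sE -(rmorphB (real_complex R)) [in X in _ -> X]eE.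
rewrite nE => lt_e.
by rewrite -[_ < _]/(Order.lt ((`|l - complex.Re (s n)|)%:C)%C ((complex.Re e)%:C)%C : bool) ltcR.
Qed.

Lemma has_sum_cvg_norm u s : has_sum u s -> cvgn (psum (fun k => `|u k|)).
Proof.
move=> [[M uM] _]; apply: (@nondecreasing_bounded_cvgn _ M) => //.
- by move=> n; exact: psum_ge0.
- exact: psum_nd.
Qed.

Lemma has_sumM u v s t :
  has_sum u s -> has_sum v t -> has_sum (cprod u v) (s * t).
Proof.
move=> us vt.
exact: (has_sumM_cvg (has_sum_cvg_norm us) (has_sum_cvg_norm vt) us vt).
Qed.

End complex_has_sum.

Section analytic.
Variables (R : realType) (r : nat).
Local Notation C := (Cplx R).
Local Notation E := 'rV[C]_r.

(* [taylor f a]: near 0, f is the sum of the power series with coefficients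
   a; the monomial x^k at x is [mmap1 (x 0) k]. *)
Definition taylor (f : E -> C) (a : multinom r -> C) : Prop :=
  \forall x \near (0 : E), has_sum (fun k => a k * mmap1 ((x : E) 0) k) (f x).

Definition analytic_at0 : {pred E -> C} := [pred f | `[< exists a, taylor f a >]].

Lemma mmap1_add (h : 'I_r -> C) (k1 k2 : multinom r) :
  mmap1 h (mnm_add k1 k2) = mmap1 h k1 * mmap1 h k2.
Proof.
rewrite /mmap1 -big_split/=; apply: eq_bigr => i _.
by rewrite mnmE exprD.
Qed.

Lemma taylorB f g a b : taylor f a -> taylor g b ->
  taylor (f - g) (fun k => a k - b k).
Proof.
apply: filterS2 => x fx gx.
rewrite (_ : (fun k => _) = (fun k => a k * mmap1 (x 0) k - b k * mmap1 (x 0) k)).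
  exact: has_sumB fx gx.
by apply/funext => k; rewrite mulrBl.
Qed.

Lemma taylorM f g a b : taylor f a -> taylor g b ->
  taylor (f * g) (cprod a b).
Proof.
apply: filterS2 => x fx gx.
rewrite (_ : (fun k => _) =
  cprod (fun k => a k * mmap1 (x 0) k) (fun k => b k * mmap1 (x 0) k)).
  exact: has_sumM fx gx.
apply/funext => k; rewrite /cprod mulr_suml; apply: eq_bigr => k1 _.
rewrite mulr_suml; apply: eq_bigr => k2 /eqP kE.
by rewrite [X in mmap1 _ X]kE mmap1_add mulrACA.
Qed.

Definition monomial_fun (m : multinom r) : E -> C := fun x => mmap1 (x 0) m.

Lemma taylor_monomial (m : multinom r) :
  taylor (monomial_fun m) (fun k => if k == m then 1 else 0).
Proof.
rewrite /taylor; near=> x.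
rewrite (_ : (fun k => _) = (fun k => if k == m then mmap1 (x 0) m else 0)).
  exact: has_sum1.
by apply/funext => k; case: eqP => [->|_]; rewrite ?mul1r ?mul0r.
Unshelve. all: by end_near. Qed.

Lemma analytic_at0_subring : subring_closed analytic_at0.
Proof.
split.
- apply/asboolP; exists (fun k => if k == @mnm0 r then 1 else 0).
  have -> : 1 = monomial_fun (@mnm0 r); last exact: taylor_monomial.
  apply/funext => x; rewrite /monomial_fun /mmap1 big1// => i _.
  by rewrite mnmE expr0.
- move=> f g /asboolP[a fa] /asboolP[b gb]; apply/asboolP.
  by exists (fun k => a k - b k); exact: taylorB.
- move=> f g /asboolP[a fa] /asboolP[b gb]; apply/asboolP.
  by exists (cprod a b); exact: taylorM.
Qed.

HB.instance Definition _ :=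
  GRing.isSubringClosed.Build (E -> C) analytic_at0 analytic_at0_subring.

Record analytic := Analytic {
  analytic_fun :> E -> C;
  analytic_funP : analytic_fun \in analytic_at0 }.

HB.instance Definition _ := [isSub for analytic_fun].
HB.instance Definition _ := [Choice of analytic by <:].
HB.instance Definition _ := [SubChoice_isSubComNzRing of analytic by <:].

Lemma taylor_ex (f : analytic) : exists a, taylor f a.
Proof. exact/asboolP/analytic_funP. Qed.

(* Taylor coefficients are unique, so the choice made by [cid] is immaterial. *)
Definition taylor_coef (f : analytic) : multinom r -> C :=
  sval (cid (taylor_ex f)).

Lemma taylor_coefP (f : analytic) : taylor f (taylor_coef f).
Proof. by rewrite /taylor_coef; case: cid. Qed.

Lemma monomial_analytic (m : multinom r) : monomial_fun m \in analytic_at0.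
Proof. by apply/asboolP; eexists; exact: taylor_monomial. Qed.

Definition monomial (m : multinom r) : analytic :=
  Analytic (monomial_analytic m).

End analytic.

Section germs.
Variables (R : realType) (r : nat) (X : set 'rV[Cplx R]_r).
Local Notation A := (analytic R r).

Definition germ_eq : rel A :=
  fun f g => `[< \forall x \near (0 : 'rV[Cplx R]_r), X x -> f x = g x >].

Lemma germ_eq_is_equiv : equiv_class_of germ_eq.
Proof.
split=> [f|f g|g f h].
- by apply/asboolP; exact: filterE.
- by apply/asboolP/asboolP; apply: filterS => x fg /fg.
- move=> /asboolP fg /asboolP gh; apply/asboolP.
  by apply: filterS2 fg gh => x fg gh Xx; rewrite fg// gh.
Qed.

Canonical germ_eq_equiv := EquivRelPack germ_eq_is_equiv.
Canonical germ_eq_encModRel := defaultEncModRel germ_eq.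

(* The ring of germs at 0 of analytic functions on X: two analytic functions
   are identified when they agree on X near 0. If 0 is not in the closure of X
   this is the zero ring, hence only a comPzRingType. *)
Definition germs := {eq_quot germ_eq}.

HB.instance Definition _ : EqQuotient A germ_eq germs := EqQuotient.on germs.
HB.instance Definition _ := Choice.on germs.

Lemma germ_eqP (f g : A) :
  reflect (\forall x \near (0 : 'rV[Cplx R]_r), X x -> f x = g x)
          (f == g %[mod germs]).
Proof. by rewrite piE; exact: asboolP. Qed.

Let repr_germ (f : A) : \forall x \near (0 : 'rV[Cplx R]_r),
  X x -> f x = repr (\pi_germs f) x.
Proof. by apply/germ_eqP; rewrite reprK. Qed.

Definition germ_zero : germs := lift_cst germs 0.
Definition germ_one : germs := lift_cst germs 1.
Definition germ_add := lift_op2 germs +%R.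
Definition germ_opp := lift_op1 germs -%R.
Definition germ_mul := lift_op2 germs *%R.

Canonical pi_germ_zero := PiConst germ_zero.
Canonical pi_germ_one := PiConst germ_one.

Lemma pi_opp : {morph \pi : f / - f >-> germ_opp f}.
Proof.
move=> f; unlock germ_opp; apply/eqP/germ_eqP.
by apply: filterS (repr_germ f) => x fE /fE /=; rewrite !fctE => ->.
Qed.
Canonical pi_germ_opp := PiMorph1 pi_opp.

Lemma pi_add : {morph \pi : f g / f + g >-> germ_add f g}.
Proof.
move=> f g; unlock germ_add; apply/eqP/germ_eqP.
apply: filterS2 (repr_germ f) (repr_germ g) => x fE gE Xx /=.
by rewrite !fctE fE// gE.
Qed.
Canonical pi_germ_add := PiMorph2 pi_add.

Lemma pi_mul : {morph \pi : f g / f * g >-> germ_mul f g}.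
Proof.
move=> f g; unlock germ_mul; apply/eqP/germ_eqP.
apply: filterS2 (repr_germ f) (repr_germ g) => x fE gE Xx /=.
by rewrite !fctE fE// gE.
Qed.
Canonical pi_germ_mul := PiMorph2 pi_mul.

Lemma germ_addA : associative germ_add.
Proof. by move=> x y z; rewrite -[x]reprK -[y]reprK -[z]reprK !piE addrA. Qed.

Lemma germ_addC : commutative germ_add.
Proof. by move=> x y; rewrite -[x]reprK -[y]reprK !piE addrC. Qed.

Lemma germ_add0 : left_id germ_zero germ_add.
Proof. by move=> x; rewrite -[x]reprK !piE add0r. Qed.

Lemma germ_addN : left_inverse germ_zero germ_opp germ_add.
Proof. by move=> x; rewrite -[x]reprK !piE addNr. Qed.

HB.instance Definition _ :=
  GRing.isZmodule.Build germs germ_addA germ_addC germ_add0 germ_addN.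
HB.instance Definition _ := @isZmodQuotient.Build A germ_eq 0 -%R +%R germs
  (lock _) pi_opp pi_add.

Lemma germ_mulA : associative germ_mul.
Proof. by move=> x y z; rewrite -[x]reprK -[y]reprK -[z]reprK !piE mulrA. Qed.

Lemma germ_mulC : commutative germ_mul.
Proof. by move=> x y; rewrite -[x]reprK -[y]reprK !piE mulrC. Qed.

Lemma germ_mul1 : left_id germ_one germ_mul.
Proof. by move=> x; rewrite -[x]reprK !piE mul1r. Qed.

Lemma germ_mulDl : left_distributive germ_mul +%R.
Proof.
move=> x y z; rewrite -[x]reprK -[y]reprK -[z]reprK.
by rewrite !piE mulrDl.
Qed.

HB.instance Definition _ := GRing.Zmodule_isComPzRing.Build germs
  germ_mulA germ_mulC germ_mul1 germ_mulDl.

Definition germ (f : A) : germs := \pi_germs f.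

Lemma germP (f g : A) : germ f = germ g <->
  \forall x \near (0 : 'rV[Cplx R]_r), X x -> f x = g x.
Proof.
by split => [fg|fg]; [apply/germ_eqP/eqP; exact: fg|apply/eqP/germ_eqP].
Qed.

Lemma germ_surj (g : germs) : exists f, germ f = g.
Proof. by exists (repr g); exact: reprK. Qed.

Lemma germ_is_zmod_morphism : zmod_morphism germ.
Proof. by move=> f g; rewrite /germ !piE. Qed.

Lemma germ_is_monoid_morphism : monoid_morphism germ.
Proof. by split => [|f g]; rewrite /germ !piE. Qed.

HB.instance Definition _ :=
  GRing.isZmodMorphism.Build A germs germ germ_is_zmod_morphism.
HB.instance Definition _ :=
  GRing.isMonoidMorphism.Build A germs germ germ_is_monoid_morphism.

End germs.

Section convexity.
Variables (R : realType) (n : nat).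
Local Notation V := 'rV[R]_n.

Definition convex_hull (A : set V) : set V := smallest (@convex_set R V) A.

(* The dimension of a cone is that of the linear subspace it spans. *)
Definition cone_dim (A : set V) (d : nat) : Prop :=
  exists W : {vspace V},
    [/\ forall x, A x -> x \in W,
        forall W' : {vspace V}, (forall x, A x -> x \in W') -> (W <= W')%VS
      & \dim W = d].

Definition strongly_convex (A : set V) : Prop :=
  A `&` [set - x | x in A] = [set 0].

End convexity.

Section toric.
Variables (R : realType) (n r : nat) (b : 'I_r -> 'rV[int]_n).
Local Notation C := (Cplx R).

Definition pos_part (al : 'I_r -> int) : multinom r :=
  Multinom (mktuple (fun i => `|Num.max (al i) 0|%N)).

Definition neg_part (al : 'I_r -> int) : multinom r :=
  pos_part (fun i => - al i).

Definition toric_ideal : set (mpoly r C) :=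
  ideal_gen [set mpolyX C (pos_part al) - mpolyX C (neg_part al) |
              al in [set al | \sum_i b i *~ al i = 0]].

Definition toric_variety : set 'rV[C]_r :=
  [set x | forall p, toric_ideal p -> meval (x 0) p = 0].

Definition toR : 'rV[int]_n -> 'rV[R]_n := map_mx intr.

(* The element k_1 b_1 + ... + k_r b_r of the semigroup S. *)
Definition S_point (k : multinom r) : 'rV[int]_n := \sum_i b i *+ k i.

Definition cone : set 'rV[R]_n :=
  [set x | exists2 la : 'I_r -> R,
             forall i, 0 <= la i & x = \sum_i la i *: toR (b i)].

Definition Gamma_plus (A : set 'rV[int]_n) : set 'rV[R]_n :=
  convex_hull [set toR k + v | k in A & v in cone].

(* The support is read off the Taylor expansion of a chosen extension f to
   C^r of a germ on the variety; two extensions of the same germ may have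
   different supports. *)
Definition supp (f : analytic R r) : set 'rV[int]_n :=
  [set S_point k | k in [set k | taylor_coef f k != 0]].

Definition C_hull (J : set (germs toric_variety)) : set 'rV[R]_n :=
  convex_hull [set toR (S_point la) |
                la in [set la | J (germ toric_variety (monomial R la))]].

End toric.

Arguments toric_ideal R {n r} b.
Arguments toric_variety R {n r} b.
Arguments cone R {n r} b.

(* Main.v *)
(* Suppose that the exponent s of a monomial integral over I lies outside
   Gamma_+(I). By Dickson's lemma Gamma_+(I) is a polyhedron, so that Farkas'
   lemma yields a linear form w, positive on all the b_i, and a number t with
   w(s) < t <= w(k) for all k in the support of the generators. The points
   x_N = (exp(- w(b_i)) ^ N)_i lie on X(S) and converge to 0. Along them the
   generators of I, hence its elements, are O(rho^N) with rho = exp(- t), and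
   those of I^i are O(rho^(i N)), whereas the monomial equals sigma^N with
   sigma = exp(- w(s)) > rho. Dividing an equation of integral dependence of
   degree m by sigma^(m N) and letting N tend to infinity gives 1 = 0. *)
Require Import Defs.
From HB Require Import structures.
From mathcomp Require Import all_boot all_order all_algebra.
From mathcomp Require Import all_classical all_reals all_analysis.
From mathcomp Require Import complex.
From mathcomp Require Import -(notations) mpoly.
From mathcomp Require Import zify.

Set Implicit Arguments.
Unset Strict Implicit.
Unset Printing Implicit Defensive.

Import Order.TTheory GRing.Theory Num.Theory numFieldNormedType.Exports.
Local Open Scope classical_set_scope.
Local Open Scope ring_scope.

(** * Dickson's lemma, Farkas' lemma and the Newton polyhedron *)

(** Induction on the number [d] of compared coordinates. Let [F0] serve the first [d] of them and
    let [N] bound coordinate [d] on [F0]: elements whose coordinate [d] is at least [N] are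
    dominated from [F0], and the finitely many slices below [N] fall to the induction hypothesis. *)
Lemma dickson_prefix (d : nat) (K : set (nat -> nat)) :
  exists2 F : seq (nat -> nat), (forall k, k \in F -> K k) &
    forall k, K k -> exists2 k', k' \in F &
      forall i, (i < d)%N -> (k' i <= k i)%N.
Proof.
elim: d K => [|d IHd] K.
  have [[k Kk]|K0] := pselect (exists k, K k).
    by exists [:: k] => [j|j _]; [rewrite inE => /eqP ->|exists k; rewrite ?inE].
  by exists [::] => // k Kk; case: K0; exists k.
have [F0 F0K F0P] := IHd K.
have /choice[F FKP] (m : nat) : exists F : seq (nat -> nat),
    (forall k, k \in F -> K k) /\ (forall k, K k -> k d = m ->
    exists2 k', k' \in F & forall i, (i < d.+1)%N -> (k' i <= k i)%N).
  have [F FK FP] := IHd [set k | K k /\ k d = m].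
  exists F; split => [k /FK[]//|k Kk km].
  have [k' k'F k'k] := FP k (conj Kk km); exists k' => // i.
  rewrite ltnS leq_eqVlt => /predU1P[->|/k'k//].
  by have [_ ->] := FK _ k'F; rewrite km.
have {FKP}[FK FP] := all_and2 FKP.
pose N := (\max_(k <- F0) k d)%N.
exists (F0 ++ flatten [seq F m | m <- iota 0 N]) => [k|k Kk].
  by rewrite mem_cat => /orP[/F0K//|/flatten_mapP[m _ /FK]].
have [kN|Nk] := ltnP (k d) N.
  have [k' k'F k'k] := FP _ k Kk erefl; exists k' => //.
  rewrite mem_cat; apply/orP; right; apply/flatten_mapP.
  by exists (k d); rewrite ?mem_iota.
have [k' k'F k'k] := F0P k Kk; exists k'; first by rewrite mem_cat k'F.
move=> i; rewrite ltnS leq_eqVlt => /predU1P[->|/k'k//].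
by apply: leq_trans Nk; rewrite /N (big_rem _ k'F)/= leq_maxl.
Qed.

Lemma dickson (r : nat) (K : set (multinom r)) :
  exists2 F : seq (multinom r), (forall k, k \in F -> K k) &
    forall k, K k -> exists2 k', k' \in F & forall i, (k' i <= k i)%N.
Proof.
pose toM (h : nat -> nat) : multinom r := Multinom (mktuple (fun i : 'I_r => h i)).
(* Padding by 0 beyond [r] is harmless: only the first [r] entries get compared. *)
pose ofM (k : multinom r) (j : nat) := oapp (fun i : 'I_r => k i) 0%N (insub j).
have ofMK (k : multinom r) (i : 'I_r) : ofM k i = k i by rewrite /ofM valK.
have [F FK FP] := dickson_prefix r [set h | K (toM h)].
exists [seq toM h | h <- F] => [k /mapP[h /FK hK ->]//|k Kk].
have [|h hF hk] := FP (ofM k).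
  rewrite /= (_ : toM _ = k)//; apply/mnmP => i.
  by rewrite mnmE ofMK.
exists (toM h); first exact: map_f.
by move=> i; rewrite mnmE -ofMK hk.
Qed.

(** * Linear separation over an ordered field *)

Section separation.
Variable R : realFieldType.

Definition dot n (u x : 'rV[R]_n) : R := (u *m x^T) 0 0.

Lemma dotE n (u x : 'rV[R]_n) : dot u x = \sum_j u 0 j * x 0 j.
Proof. by rewrite /dot mxE; apply: eq_bigr => j _; rewrite mxE. Qed.

Lemma dotDl n (u v x : 'rV[R]_n) : dot (u + v) x = dot u x + dot v x.
Proof. by rewrite /dot mulmxDl mxE. Qed.

Lemma dotZl n t (u x : 'rV[R]_n) : dot (t *: u) x = t * dot u x.
Proof. by rewrite /dot -scalemxAl mxE. Qed.

Lemma dotC n (u x : 'rV[R]_n) : dot u x = dot x u.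
Proof. by rewrite !dotE; apply: eq_bigr => j _; rewrite mulrC. Qed.

Lemma dotDr n (u x y : 'rV[R]_n) : dot u (x + y) = dot u x + dot u y.
Proof. by rewrite dotC dotDl !(dotC u). Qed.

Lemma dotZr n t (u x : 'rV[R]_n) : dot u (t *: x) = t * dot u x.
Proof. by rewrite dotC dotZl (dotC u). Qed.

Lemma dotBl n (u v x : 'rV[R]_n) : dot (u - v) x = dot u x - dot v x.
Proof. by rewrite dotDl -scaleN1r dotZl mulN1r. Qed.

Lemma dotBr n (u x y : 'rV[R]_n) : dot u (x - y) = dot u x - dot u y.
Proof. by rewrite dotC dotBl !(dotC u). Qed.

Lemma dot0l n (x : 'rV[R]_n) : dot 0 x = 0.
Proof. by rewrite /dot mul0mx mxE. Qed.

Lemma dot_suml n (I : finType) (u : I -> 'rV[R]_n) x :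
  dot (\sum_i u i) x = \sum_i dot (u i) x.
Proof. by rewrite /dot mulmx_suml summxE. Qed.

Lemma dot_row n m (u x : 'rV[R]_n) (v y : 'rV[R]_m) :
  dot (row_mx u v) (row_mx x y) = dot u x + dot v y.
Proof. by rewrite /dot tr_row_mx mul_row_col mxE. Qed.

(* Bartl's induction: if c is not implied by the forms a_1, ..., a_m, pick a
   witness x of this; then a_0 x < 0, and all forms can be projected along x
   onto the hyperplane a_0 = 0. *)
Lemma farkas n m (a : 'I_m -> 'rV[R]_n) (c : 'rV[R]_n) :
  (forall x, (forall i, 0 <= dot (a i) x) -> 0 <= dot c x) ->
  exists2 la : 'I_m -> R, forall i, 0 <= la i & c = \sum_i la i *: a i.
Proof.
elim: m a c => [|m IHm] a c ac.
  exists (fun=> 0) => //; rewrite big_ord0; apply/rowP => j; rewrite mxE.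
  (* Without forms, the hypothesis at [- c] reads [0 <= - dot c c], which forces [c = 0]. *)
  have /ac : forall i, 0 <= dot (a i) (- c) by case.
  rewrite -scaleN1r dotZr mulN1r oppr_ge0 dotE => c0.
  have /psumr_eq0P cj0 : \sum_j c 0 j * c 0 j = 0.
    by apply/eqP; rewrite eq_le c0 sumr_ge0// => i _; rewrite -expr2 sqr_ge0.
  apply/eqP; rewrite -sqrf_eq0 expr2 cj0// => i _.
  by rewrite -expr2 sqr_ge0.
pose tl i := a (lift ord0 i).
have [atl|] := pselect (forall x, (forall i, 0 <= dot (tl i) x) -> 0 <= dot c x).
  have [la la0 cE] := IHm _ _ atl.
  exists (fun i => oapp la 0 (unlift ord0 i)) => [i|]; first by case: unliftP => /=.
  rewrite big_ord_recl unlift_none scale0r add0r cE.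
  by apply: eq_bigr => i _; rewrite liftK.
move=> /existsNP[z] /not_implyP[tlz /negP]; rewrite -ltNge => cz.
have az : dot (a ord0) z < 0.
  rewrite ltNge; apply/negP => az; move: cz; rewrite ltNge ac// => i.
  by case: (unliftP ord0 i) => [j|] ->; [exact: tlz|].
(* [p v] is [v] composed with the projection along [z] onto the kernel of [a ord0]; see [pE]. *)
pose p v := v - (dot v z / dot (a ord0) z) *: a ord0.
have pE v x : dot (p v) x = dot v (x - (dot (a ord0) x / dot (a ord0) z) *: z).
  rewrite /p dotBl dotZl dotBr dotZr.
  by rewrite mulrAC [X in _ = _ - X]mulrAC (mulrC (dot v z)).
have [|la la0 pc] := IHm (p \o tl) (p c).
  move=> x px; rewrite pE; apply: ac => i.
  case: (unliftP ord0 i) => [j|] ->; first by rewrite -pE; exact: px.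
  by rewrite dotBr dotZr divfK ?lt_eqF// subrr.
(* Expanding the relation for [p c] gives the coefficient of [a ord0], a quotient of two negative
   numbers. *)
exists (fun i => oapp la ((dot c z - \sum_j la j * dot (tl j) z) / dot (a ord0) z)
    (unlift ord0 i)) => [i|].
  case: unliftP => [j _|_]/=; first exact: la0.
  rewrite mulr_le0// ?invr_le0 ?ltW// subr_lt0 (lt_le_trans cz)// sumr_ge0// => j _.
  by rewrite mulr_ge0.
rewrite big_ord_recl unlift_none/=.
rewrite -[LHS](subrK ((dot c z / dot (a ord0) z) *: a ord0)).
rewrite -/(p c) pc addrC mulrBl scalerBl -addrA; congr (_ + _).
rewrite mulr_suml scaler_suml -sumrN -big_split/=; apply: eq_bigr => i _.
by rewrite liftK/= scalerBr scalerA mulrA addrC.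
Qed.

(* Homogenization: Farkas' lemma for the vectors (p_i, 1), (b_j, 0) and the
   target (s, 1). *)
Lemma separation n m r (p : 'I_m -> 'rV[R]_n) (b : 'I_r -> 'rV[R]_n)
    (s : 'rV[R]_n) :
  (forall (mu : 'I_m -> R) (la : 'I_r -> R),
    (forall i, 0 <= mu i) -> (forall j, 0 <= la j) ->
    \sum_i mu i = 1 -> s <> \sum_i mu i *: p i + \sum_j la j *: b j) ->
  exists w t, [/\ forall j, 0 <= dot (b j) w, forall i, t <= dot (p i) w &
                  dot s w < t].
Proof.
move=> sN.
pose a (i : 'I_(m + r)) : 'rV[R]_(n + 1) :=
  match fintype.split i with inl i => row_mx (p i) 1 | inr j => row_mx (b j) 0 end.
have al i : a (lshift r i) = row_mx (p i) 1.
  by rewrite /a; case: split_ordP => [j /lshift_inj ->|j /eqP]//; rewrite eq_lrshift.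
have ar j : a (rshift m j) = row_mx (b j) 0.
  by rewrite /a; case: split_ordP => [i /eqP|i /rshift_inj ->]//; rewrite eq_rlshift.
have [/(farkas (c := row_mx s 1))[la la0]|] := pselect (forall x,
    (forall i, 0 <= dot (a i) x) -> 0 <= dot (row_mx s 1) x).
  (* The last coordinate of [sE] says that the weights of the [p i] sum to 1, the others give the
     decomposition of [s] that [sN] excludes. *)
  rewrite big_split_ord/= => sE; exfalso.
  have := congr1 rsubmx sE; have := congr1 lsubmx sE.
  rewrite row_mxKl row_mxKr !linearD !linear_sum/=.
  under eq_bigr do rewrite linearZ/= al row_mxKl.
  under [X in _ + X]eq_bigr do rewrite linearZ/= ar row_mxKl.
  move=> s1.
  under eq_bigr do rewrite linearZ/= al row_mxKr.
  rewrite [X in _ + X]big1 => [/matrixP/(_ 0 0)|j _]; last first.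
    by rewrite linearZ/= ar row_mxKr scaler0.
  rewrite addr0 summxE mxE/=.
  under eq_bigr do rewrite mxE mxE/= mulr1.
  by move=> /esym mu1; apply: sN mu1 s1.
move=> /existsNP[x] /not_implyP[ax /negP]; rewrite -ltNge => sx.
have dot11 (y : 'rV[R]_1) : dot 1 y = y 0 0.
  by rewrite dotE big_ord1 !mxE mul1r.
(* The witness [x] is read as the pair (w, -t). *)
exists (lsubmx x), (- (rsubmx x 0 0)); split => [j|i|].
- by have := ax (rshift m j); rewrite ar -{1}[x]hsubmxK dot_row dot0l addr0.
- have := ax (lshift r i); rewrite al -[x in X in X -> _]hsubmxK dot_row dot11.
  by rewrite -lerBlDr sub0r.
- by rewrite -subr_lt0 opprK -dot11 -dot_row hsubmxK.
Qed.
End separation.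

(** Induction on [m]: split off the first point and renormalize the other weights by their total
    [t]; if [t = 0], they all vanish. *)
Lemma convex_set_sum (R : realFieldType) (V : lmodType R) (A : set V) m
    (p : 'I_m -> V) (mu : 'I_m -> R) : convex_set A ->
  (forall i, A (p i)) -> (forall i, 0 <= mu i) -> \sum_i mu i = 1 ->
  A (\sum_i mu i *: p i).
Proof.
move=> cA; elim: m p mu => [|m IHm] p mu Ap mu0.
  by rewrite big_ord0 => /eqP; rewrite eq_sym oner_eq0.
rewrite !big_ord_recl => mu1.
set t := \sum_(i < m) _ in mu1.
have t0 : 0 <= t by exact: sumr_ge0.
have [tz|tn] := eqVneq t 0.
  rewrite big1 ?addr0 => [|i _]; first by rewrite tz addr0 in mu1; rewrite mu1 scale1r.
  by move/psumr_eq0P : tz => -> //; rewrite scale0r.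
have m01 : 0 <= mu ord0 <= 1 by rewrite mu0 -mu1 lerDl.
have tE : t = 1 - mu ord0 by rewrite -mu1 addrC addKr.
have := cA (p ord0) (\sum_(i < m) (mu (lift ord0 i) / t) *: p (lift ord0 i))
  (Itv01 (mu0 _) (proj2 (andP m01))).
rewrite !inE; set q := conv _ _ _ => cq.
suff <- : q = mu ord0 *: p ord0 + \sum_(i < m) mu (lift ord0 i) *: p (lift ord0 i).
  apply: cq; first exact: Ap.
  apply: IHm => [i|i|]; [exact: Ap|by rewrite divr_ge0|].
  by rewrite -mulr_suml divff.
rewrite -[q]/(mu ord0 *: p ord0 + (1 - mu ord0) *: _) -tE.
congr (_ + _); rewrite scaler_sumr; apply: eq_bigr => i _.
by rewrite scalerA mulrC divfK.
Qed.

(** * Separating a point from the Newton polyhedron *)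

Section Gamma_plus_separation.
Variables (R : realType) (n r : nat) (b : 'I_r -> 'rV[int]_n).

Lemma toR_S_point (k : multinom r) :
  toR R (S_point b k) = \sum_i (k i)%:R *: toR R (b i).
Proof.
rewrite /toR /S_point raddf_sum; apply: eq_bigr => i _.
by rewrite raddfMn scaler_nat.
Qed.

Lemma dot_S_point (k : multinom r) (w : 'rV[R]_n) :
  dot (toR R (S_point b k)) w = \sum_i (k i)%:R * dot (toR R (b i)) w.
Proof. by rewrite toR_S_point dot_suml; apply: eq_bigr => i _; rewrite dotZl. Qed.

(** If [b i = 0], the relation e_i puts x_i - 1 into the toric ideal, and this polynomial does not
    vanish at the origin. *)
Lemma origin_generator_neq0 : toric_variety R b 0 -> forall i, b i != 0.
Proof.
move=> X0 i; apply/negP => /eqP bi0.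
pose al (j : 'I_r) : int := (j == i)%:R.
have : toric_ideal R b (mpolyX (Cplx R) (pos_part al) - mpolyX (Cplx R) (neg_part al)).
  move=> I [_]; apply; exists al => //=.
  by rewrite (bigD1 i)//= bi0 mul0rz big1 ?addr0// => j /negPf ji; rewrite /al ji mulr0z.
move=> /X0; rewrite mevalB !mevalX (bigD1 i)//= !mxE mnmE /al eqxx expr1 mul0r sub0r.
rewrite big1 => [/eqP|j _]; first by rewrite oppr_eq0 oner_eq0.
by rewrite !mxE mnmE; case: eqP.
Qed.

(* By Dickson's lemma, [Gamma_plus] is a polyhedron whose recession cone is
   [cone], so that a point outside it is strictly separated from it; adding a
   small multiple of the sum of the coordinates makes the separating form
   positive on all generators. *)
Lemma Gamma_plus_separation (K : set (multinom r)) (s : 'rV[R]_n) :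
  (forall i j, 0 <= b i 0 j) -> (forall i, b i != 0) -> (forall j, 0 <= s 0 j) ->
  ~ Gamma_plus b [set S_point b k | k in K] s ->
  exists w t, [/\ forall i, 0 < dot (toR R (b i)) w,
    forall k, K k -> t <= dot (toR R (S_point b k)) w & dot s w < t].
Proof.
move=> b0 bn0 s0 sG.
have [F FK FP] := dickson K.
pose p i := toR R (S_point b (tnth (in_tuple F) i)).
have [|w [t [bw Fw sw]]] := separation (p := p)
    (b := fun i => toR R (b i)) (s := s).
  move=> mu la mu0 la0 mu1 sE; apply: sG => A [cA GA].
  (* Since the weights sum to 1, the cone part can be moved into each summand, which then lies in
     the set generating [Gamma_plus]. *)
  have -> : s = \sum_i mu i *: (p i + \sum_j la j *: toR R (b j)).
    under eq_bigr do rewrite scalerDr.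
    by rewrite big_split/= -scaler_suml mu1 scale1r.
  apply: convex_set_sum => // i; apply: GA => /=.
  exists (S_point b (tnth (in_tuple F) i)).
    by exists (tnth (in_tuple F) i); first exact/FK/mem_tnth.
  by exists (\sum_j la j *: toR R (b j)); first by exists la.
pose u : 'rV[R]_n := const_mx 1.
have dotu v : dot v u = \sum_j v 0 j.
  by rewrite dotE; apply: eq_bigr => j _; rewrite mxE mulr1.
have su0 : 0 <= dot s u by rewrite dotu sumr_ge0.
have bu0 i : 0 < dot (toR R (b i)) u.
  have bij0 j : 0 <= toR R (b i) 0 j by rewrite mxE ler0z.
  rewrite lt_neqAle dotu sumr_ge0// andbT eq_sym psumr_neq0//.
  have /rV0Pn[j bj] := bn0 i; apply/hasP; exists j; rewrite ?mem_index_enum//=.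
  by rewrite lt_neqAle bij0 andbT eq_sym mxE intr_eq0.
(* Chosen so that [e * dot s u < t - dot s w]; the 1 keeps the denominator positive when
   [dot s u = 0]. *)
pose e := (t - dot s w) / (dot s u + 1).
have e0 : 0 < e by rewrite divr_gt0 ?subr_gt0 ?ltr_wpDl.
exists (w + e *: u), t; split => [i|k Kk|].
- by rewrite dotDr dotZr ltr_wpDl// mulr_gt0.
- have [k' /(tnthP (in_tuple F))[i k'i] k'k] := FP k Kk.
  apply: le_trans (Fw i) _; rewrite /p -k'i !dot_S_point; apply: ler_sum => j _; rewrite dotDr dotZr.
  by rewrite ler_pM// ?ler_nat// lerDl mulr_ge0// ltW.
- rewrite dotDr dotZr -ltrBrDl mulrAC ltr_pdivrMr ?ltr_wpDl//.
  by rewrite ltr_pM2l ?subr_gt0// ltrDl.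
Qed.
End Gamma_plus_separation.

(** * Growth of germs along a geometric sequence of points *)

Lemma cvg_sum0 (K : numFieldType) m (u : 'I_m -> nat -> K) :
  (forall i, u i @ \oo --> (0 : K)) -> (fun N => \sum_i u i N) @ \oo --> (0 : K).
Proof.
elim: m u => [|m IHm] u u0.
  by under eq_cvg do rewrite big_ord0; exact: cvg_cst.
under eq_cvg do rewrite big_ord_recl.
have tl0 := IHm (fun i => u (lift ord0 i)) (fun i => u0 (lift ord0 i)).
have := @cvgD K K _ _ _ (u ord0) _ 0 0 (u0 ord0) tl0; rewrite addr0.
exact.
Qed.

Section analytic_eval.
Variables (R : realType) (r : nat) (x : 'rV[Cplx R]_r).
Implicit Types f g : analytic R r.

Lemma analyticD f g : (f + g) x = f x + g x.
Proof. by []. Qed.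

Lemma analyticM f g : (f * g) x = f x * g x.
Proof. by []. Qed.

Lemma analyticX f m : (f ^+ m) x = f x ^+ m.
Proof. by elim: m => [//|m IHm]; rewrite !exprS analyticM IHm. Qed.

Lemma analytic_sum (I : finType) (F : I -> analytic R r) :
  (\sum_i F i) x = \sum_i F i x.
Proof. exact: (big_morph (fun f : analytic R r => f x) analyticD). Qed.
End analytic_eval.

Section geometric_points.
Variable R : realType.
Local Notation C := (Cplx R).

Definition toC (x : R) : C := (x%:C)%C.

Lemma toCM x y : toC (x * y) = toC x * toC y.
Proof. exact: (rmorphM (real_complex R)). Qed.

Lemma toCX x m : toC (x ^+ m) = toC x ^+ m.
Proof. exact: (rmorphXn (real_complex R)). Qed.

Lemma toC_prod (I : finType) (F : I -> R) : toC (\prod_i F i) = \prod_i toC (F i).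
Proof. exact: (rmorph_prod (real_complex R)). Qed.

Lemma ler_toC x y : (toC x <= toC y) = (x <= y).
Proof. exact: lecR. Qed.

Lemma ltr_toC x y : (toC x < toC y) = (x < y).
Proof. exact: ltcR. Qed.

Lemma toC_gt0 x : (0 < toC x) = (0 < x).
Proof. exact: (ltr_toC 0). Qed.

Lemma cvg_toC_expr (x : R) : 0 <= x < 1 -> (fun N => toC x ^+ N) @ \oo --> (0 : C).
Proof.
move=> /andP[x0 x1]; apply/cvgrPdist_lt => e e0.
have eE : e = toC (complex.Re e).
  by rewrite /toC RRe_real //; apply: ger0_real; exact: ltW.
have Re0 : 0 < complex.Re e by rewrite eE toC_gt0 in e0.
have /cvgrPdist_lt/(_ _ Re0) : (fun N => x ^+ N) @ \oo --> (0 : R).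
  by apply: cvg_expr; rewrite ger0_norm.
apply: filterS => N; rewrite !sub0r !normrN -toCX !ger0_norm ?exprn_ge0//.
  by rewrite [in X in _ -> X]eE ltr_toC.
by rewrite -[0]/(toC 0) ler_toC exprn_ge0.
Qed.

(** The order of [C] is partial, but [B] is real because it dominates a norm; hence it is comparable
    with [|s|]. *)
Lemma cvgn_norm_le (u : nat -> C) (s B : C) :
  u @ \oo --> s -> (forall N, `|u N| <= B) -> `|s| <= B.
Proof.
move=> us uB.
have Breal : B \is Num.real by apply: ger0_real; apply: le_trans (uB 0%N).
rewrite real_leNgt//; apply/negP => Bs.
have e0 : 0 < `|s| - B by rewrite subr_gt0.
move/cvgrPdist_lt : us => /(_ _ e0)[N _ /(_ N (leqnn N))].
apply/negP; rewrite -real_leNgt ?realB//.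
rewrite lerBlDr; apply: le_trans (lerD (lexx _) (uB N)).
by rewrite -[X in `|X| <= _](subrK (u N)) ler_normD.
Qed.

Variables (r : nat) (p : 'I_r -> R).
Hypothesis p01 : forall i, 0 < p i < 1.

Definition geo_pt (N : nat) : 'rV[C]_r := \row_i toC (p i) ^+ N.

Lemma cvg_geo_pt : geo_pt @ \oo --> (0 : 'rV[C]_r).
Proof.
apply/cvg_ballP => e e0; near=> N.
split=> // i j; rewrite ord1 !mxE.
move: j; near: N; apply: filter_forall => j.
have pj01 : 0 <= p j < 1 by have /andP[/ltW -> ->] := p01 j.
by have /cvg_ballP := cvg_toC_expr pj01; exact.
Unshelve. all: by end_near. Qed.

Definition mon_val (k : multinom r) : R := \prod_i p i ^+ k i.

Lemma mmap1_geo_pt N k : mmap1 (geo_pt N 0) k = toC (mon_val k) ^+ N.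
Proof.
rewrite /mmap1 /mon_val -toCX -prodrXl toC_prod; apply: eq_bigr => i _.
by rewrite mxE -!toCX exprAC.
Qed.

Lemma mon_val_gt0 k : 0 < mon_val k.
Proof. by apply: prodr_gt0 => i _; rewrite exprn_gt0//; have /andP[] := p01 i. Qed.

Lemma mon_val_le1 k : mon_val k <= 1.
Proof.
apply: prodr_ile1 => i; have /andP[p0 p1] := p01 i.
by rewrite exprn_ge0 ?exprn_ile1 ?ltW.
Qed.

(** Only large [N] count, because Taylor expansions and equalities of germs hold only near 0. *)
Definition geo_bounded (rho : R) (f : analytic R r) : Prop :=
  exists M : C, \forall N \near \oo, `|f (geo_pt N)| <= M * toC rho ^+ N.

(** Fix [N0] beyond which the expansion holds. From [N0] to [N], each nonzero term shrinks at least
    by the factor [rho ^+ (N - N0)], so the bound [M] on the absolute sums at [N0] controls all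
    later values. *)
Lemma geo_bounded_taylor rho (f : analytic R r) a : 0 < rho -> taylor f a ->
  (forall k, a k != 0 -> mon_val k <= rho) -> geo_bounded rho f.
Proof.
move=> rho0 fa arho.
have rhoC0 : 0 < toC rho by rewrite toC_gt0.
have /cvg_geo_pt [N0 _ near0] := fa.
have [[M uM] _] := near0 N0 (leqnn N0).
exists (M / toC rho ^+ N0), N0 => // N /= N0N.
have [_ fN] := near0 N N0N.
have -> : M / toC rho ^+ N0 * toC rho ^+ N = toC rho ^+ (N - N0) * M.
  rewrite -[in LHS](subnK N0N) exprD mulrAC -!mulrA.
  by rewrite divff ?mulr1 1?mulrC// gt_eqF ?exprn_gt0.
apply: cvgn_norm_le fN _ => D.
apply: le_trans (ler_norm_sum _ _ _) _.
apply: le_trans (ler_wpM2l _ (uM D)); last by rewrite exprn_ge0// ltW.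
rewrite /psum mulr_sumr; apply: ler_sum => k _.
have [->|ak] := eqVneq (a k) 0; first by rewrite !mul0r normr0 mulr0.
rewrite !normrM mulrCA ler_wpM2l// !mmap1_geo_pt.
have mk0 : 0 < toC (mon_val k) by rewrite toC_gt0 mon_val_gt0.
rewrite !normrX (gtr0_norm mk0) -[X in _ ^+ X <= _](subnK N0N) exprD.
apply: ler_wpM2r; first exact/exprn_ge0/ltW.
have mkrho : toC (mon_val k) <= toC rho by rewrite ler_toC; exact: arho.
by apply: lerXn2r mkrho; rewrite nnegrE ltW.
Qed.

(** This boundedness makes the growth condition stable under multiplication by arbitrary germs. *)
Lemma geo_bounded1 (f : analytic R r) : geo_bounded 1 f.
Proof.
have [a fa] := taylor_ex f.
by apply: (geo_bounded_taylor ltr01 fa) => k _; exact: mon_val_le1.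
Qed.

Lemma geo_bounded0 rho : 0 < rho -> geo_bounded rho 0.
Proof.
by move=> rho0; exists 0; apply: nearW => N; rewrite mul0r normr0.
Qed.

Lemma geo_boundedD rho f g :
  geo_bounded rho f -> geo_bounded rho g -> geo_bounded rho (f + g).
Proof.
move=> [M fM] [M' gM']; exists (M + M').
apply: filterS2 fM gM' => N fN gN.
rewrite [X in `|X|]/= mulrDl; apply: le_trans (ler_normD _ _) _.
exact: lerD.
Qed.

Lemma geo_boundedM rho rho' f g :
  geo_bounded rho f -> geo_bounded rho' g -> geo_bounded (rho * rho') (f * g).
Proof.
move=> [M fM] [M' gM']; exists (M * M').
apply: filterS2 fM gM' => N fN gN.
rewrite [X in `|X|]/= normrM toCM exprMn mulrACA.
exact: (ler_pM (normr_ge0 _) (normr_ge0 _) fN gN).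
Qed.

Lemma geo_bounded_cvg0 rho s (f : analytic R r) : 0 < rho < s ->
  geo_bounded rho f -> (fun N => f (geo_pt N) / toC s ^+ N) @ \oo --> (0 : C).
Proof.
move=> /andP[rho0 rhos] [M fM]; have s0 := lt_trans rho0 rhos.
have lim0 : (fun N => M * toC (rho / s) ^+ N) @ \oo --> (0 : C).
  rewrite -(mulr0 M); apply: cvgM; first exact: cvg_cst.
  by apply: cvg_toC_expr; rewrite divr_ge0 ?ltW//= ltr_pdivrMr ?mul1r.
apply/cvgr0Pnorm_lt => e e0; move/cvgr0Pnorm_lt : lim0 => /(_ e e0).
apply: filterS2 fM => N fN; apply: le_lt_trans.
have sC0 : 0 < toC s ^+ N by rewrite exprn_gt0 ?toC_gt0.
have le1 : `|f (geo_pt N) / toC s ^+ N| <= M * toC (rho / s) ^+ N.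
  rewrite normrM normfV (gtr0_norm sC0) ler_pdivrMr// -mulrA -exprMn -toCM.
  by rewrite divfK ?gt_eqF.
by rewrite (ger0_norm (le_trans (normr_ge0 _) le1)).
Qed.

(** * Growth of ideals and integral dependence *)

Variable X : set 'rV[C]_r.
Hypothesis Xgeo : forall N, X (geo_pt N).

(** The choice of representative is immaterial: representatives agree on [X] near 0, and the points
    lie on [X] and tend to 0. *)
Definition germ_geo_bounded (rho : R) : set (germs X) :=
  [set h | exists2 f, germ X f = h & geo_bounded rho f].

Lemma germ_geo_bounded_ideal rho : 0 < rho -> is_ideal (germ_geo_bounded rho).
Proof.
move=> rho0; split.
- by exists 0; [exact: rmorph0|exact: geo_bounded0].
- move=> _ _ [f <- ff] [g <- gg]; exists (f + g); first exact: rmorphD.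
  exact: geo_boundedD.
- move=> h _ [f <- ff]; have [g <-] := germ_surj h.
  exists (g * f); first exact: rmorphM.
  rewrite -[rho]mul1r; exact: (geo_boundedM (geo_bounded1 g) ff).
Qed.

(** The rates of the [j] factors multiply, and the germs of rate [rho ^+ j] form an ideal, so it is
    enough to treat products. *)
Lemma germ_geo_bounded_pow rho (I : set (germs X)) j : 0 < rho ->
  I `<=` germ_geo_bounded rho -> ideal_pow I j `<=` germ_geo_bounded (rho ^+ j).
Proof.
move=> rho0 Irho h; apply; split; first exact/germ_geo_bounded_ideal/exprn_gt0.
move=> _ [u Iu ->]; elim: j u Iu => [|j IHj] u Iu.
  by rewrite big_ord0 expr0; exists 1; [exact: rmorph1|exact: geo_bounded1].
have [f fE ff] := Irho _ (Iu ord0).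
have [|g gE gg] := IHj (fun i => u (lift ord0 i)); first by move=> i; exact: Iu.
exists (f * g); first by rewrite rmorphM/= fE gE big_ord_recl.
by rewrite exprS; exact: geo_boundedM.
Qed.

(* Evaluating an equation of integral dependence at [geo_pt N] and dividing by
   [mon_val la ^+ (N * m)] leaves a vanishing sequence plus 1. *)
Lemma integral_monomial_mon_val rho (I : set (germs X)) la : 0 < rho ->
  I `<=` germ_geo_bounded rho ->
  integral_closure I (germ X (monomial R la)) -> mon_val la <= rho.
Proof.
move=> rho0 Irho [m [a [m0 aI aE]]]; rewrite leNgt; apply/negP => rhola.
have la0 := mon_val_gt0 la.
have laC0 : toC (mon_val la) != 0 by rewrite gt_eqF// toC_gt0.
(* Lifts of the coefficients; indices outside 1..m get the default 0. *)
have /choice[f fP] i : exists f, (1 <= i <= m)%N ->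
    germ X f = a i /\ geo_bounded (rho ^+ i) f.
  have [im|im] := boolP (1 <= i <= m)%N; last by exists 0.
  by have [f fE ff] := germ_geo_bounded_pow rho0 Irho (aI i im); exists f.
have /germP : germ X (monomial R la ^+ m +
    \sum_(i < m) f i.+1 * monomial R la ^+ (m - i.+1)) = germ X 0.
  rewrite rmorphD rmorphXn rmorph_sum rmorph0 -[RHS]aE big_add1 big_mkord/=.
  congr (_ + _); apply: eq_bigr => i _.
  by rewrite rmorphM rmorphXn/=; have [|-> _] := fP i.+1; first exact: ltn_ord.
move=> /cvg_geo_pt eq0.
pose G N := \sum_(i < m) f i.+1 (geo_pt N) / toC (mon_val la ^+ i.+1) ^+ N.
have G0 : G @ \oo --> (0 : C).
  apply: cvg_sum0 => i.
  have [|_ fi] := fP i.+1; first exact: ltn_ord.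
  apply: geo_bounded_cvg0 fi; rewrite exprn_gt0//=.
  by rewrite ltrXn2r ?nnegrE ?ltW.
have /cvgrPdist_lt/(_ 1 ltr01) G1 := G0.
(* A single [N] suffices: [G N] has norm below 1 and the equation holds at [geo_pt N]. *)
have [N [GN /(_ (Xgeo N))]] := filter_ex (filterI G1 eq0).
rewrite analyticD analyticX analytic_sum -[X in _ = X]/0 => eqN.
have laN0 : toC (mon_val la) ^+ N != 0 by rewrite expf_neq0.
suff GN1 : 1 + G N = 0.
  by move: GN; rewrite sub0r normrN -(addr0_eq GN1) normrN normr1 ltxx.
apply: (mulIf (expf_neq0 m laN0)); rewrite mul0r -[RHS]eqN.
rewrite /G mulrDl mul1r mulr_suml.
have monE : monomial R la (geo_pt N) = toC (mon_val la) ^+ N.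
  exact: mmap1_geo_pt.
rewrite {1}monE; congr (_ + _); apply: eq_bigr => i _; rewrite analyticM analyticX monE.
have -> (z : C) : z ^+ m = z ^+ i.+1 * z ^+ (m - i.+1) by rewrite -exprD subnKC.
by rewrite toCX exprAC mulrA divfK// expf_neq0.
Qed.
End geometric_points.

(** * Geometric sequences on the toric variety *)

Lemma S_point_pos_neg n r (b : 'I_r -> 'rV[int]_n) (al : 'I_r -> int) :
  \sum_i b i *~ al i = 0 -> S_point b (pos_part al) = S_point b (neg_part al).
Proof.
move=> bal; apply/eqP; rewrite -subr_eq0 -bal /S_point -sumrB; apply/eqP.
apply: eq_bigr => i _; rewrite !mnmE !pmulrn !gez0_abs ?le_max ?lexx ?orbT//.
by rewrite -mulrzBr; congr (_ *~ _); lia.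
Qed.

Section toric_curve.
Variables (R : realType) (n r : nat) (b : 'I_r -> 'rV[int]_n) (w : 'rV[R]_n).

(** With these coordinates, the value of a monomial depends only on its [S_point]. *)
Definition curve_coord (i : 'I_r) : R := expR (- dot (toR R (b i)) w).

Lemma mon_val_curve k :
  mon_val curve_coord k = expR (- dot (toR R (S_point b k)) w).
Proof.
rewrite dot_S_point -sumrN expR_sum; apply: eq_bigr => i _.
by rewrite /curve_coord -expRM_natl mulrN.
Qed.

(** The polynomials vanishing at a point form an ideal, so only the binomials need checking; their
    two monomials have the same [S_point]. *)
Lemma curve_toric N : toric_variety R b (geo_pt curve_coord N).
Proof.
move=> q /(_ [set q | meval (geo_pt curve_coord N 0) q = 0]); apply.
split; last first.
  move=> _ [al bal <-] /=.
  rewrite mevalB !mevalX -!/(mmap1 _ _) !mmap1_geo_pt !mon_val_curve.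
  by rewrite (S_point_pos_neg bal) subrr.
split=> [|q1 q2 q10 q20|q1 q2 q20] /=.
- exact: meval0.
- by rewrite mevalD q10 q20 addr0.
- by rewrite mevalM q20 mulr0.
Qed.
End toric_curve.

Theorem lemma3p4 (R : realType) (n r l : nat) (b : 'I_r -> 'rV[int]_n)
  (b_ge0 : forall i j, 0 <= b i 0 j)
  (b_gen : forall v : 'rV[int]_n, exists c : 'I_r -> int,
     v = \sum_i b i *~ c i)
  (dim_cone : cone_dim (cone R b) n)
  (cone_sc : strongly_convex (cone R b))
  (origin_in_X : toric_variety R b 0)
  (g : 'I_l -> germs (toric_variety R b))
  (f : 'I_l -> analytic R r)
  (f_ext : forall i, germ (toric_variety R b) (f i) = g i) :
  C_hull (integral_closure (ideal_gen (range g)))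
    `<=` Gamma_plus b (\bigcup_i supp b (f i)).
Proof.
(* By minimality of the hull, it suffices that [Gamma_plus] is convex and contains the exponents of
   the integral monomials. *)
move=> s; apply; split.
  move=> x y t; rewrite !inE => xG yG A [cA GA].
  have xA : A x by exact: xG.
  have yA : A y by exact: yG.
  by have := cA x y t; rewrite !inE; exact.
move=> _ [la laI <-].
(* The support is lifted to exponents in N^r, where Dickson's lemma applies. *)
pose K : set (multinom r) := \bigcup_i [set k | taylor_coef (f i) k != 0].
have -> : \bigcup_i supp b (f i) = [set S_point b k | k in K].
  by rewrite /K image_bigcup.
apply: contrapT => laG.
have bn0 := origin_generator_neq0 origin_in_X.
have [j|w [t [bw Kw law]]] := Gamma_plus_separation b_ge0 bn0 _ laG.
  rewrite mxE ler0z /S_point summxE; apply: sumr_ge0 => i _.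
  by rewrite mulmxnE mulrn_wge0.
have p01 i : 0 < curve_coord b w i < 1.
  by rewrite expR_gt0 -expR0 ltr_expR oppr_lt0 bw.
have rho0 := expR_gt0 (- t).
have gI : ideal_gen (range g) `<=`
    germ_geo_bounded (curve_coord b w) (expR (- t)).
  move=> h; apply; split; first exact: germ_geo_bounded_ideal.
  move=> _ [i _ <-]; exists (f i); first exact: f_ext.
  apply: geo_bounded_taylor (taylor_coefP (f i)) _ => // k fik.
  by rewrite mon_val_curve ler_expR lerN2; apply: Kw; exists i.
(* The resulting bound exp(-w(s)) <= exp(-t), with s the point of [la], contradicts [law]. *)
have := integral_monomial_mon_val p01 (curve_toric w) rho0 gI laI.
by rewrite mon_val_curve ler_expR lerN2 leNgt law.
Qed.
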